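(* Let $n\ge2$ and $k\ge1$. Then, as subspaces of $\widetilde{U(\bar{\mathfrak n})}$, $$\iota(I_{k\Lambda_0})+\widetilde{U(\bar{\mathfrak n})\bar{\mathfrak n}_+}=\mathcal J+\widetilde{U(\bar{\mathfrak n})\bar{\mathfrak n}_+},$$ and for every dominant integral weight $\Lambda=\sum_{j=0}^nk_j\Lambda_j$ of level $k$, $$\iota(I_\Lambda)+\widetilde{U(\bar{\mathfrak n})\bar{\mathfrak n}_+}=\mathcal J+\iota\Big(\sum_{\alpha\in\Delta_+}U(\bar{\mathfrak n})x_\alpha(-1)^{k+1-\langle\alpha,\bar\Lambda\rangle}\Big)+\widetilde{U(\bar{\mathfrak n})\bar{\mathfrak n}_+}.$$
   Context: $\mathfrak g=\mathfrak{sl}(n+1)$ with simple roots $\alpha_1,\dots,\alpha_n$, positive roots $\Delta_+$, fundamental weights $\lambda_i$, root vectors $x_\alpha$ with $[x_\alpha,x_\beta]=C_{\alpha,\beta}x_{\alpha+\beta}$ ($C_{\alpha,\beta}=0$ if $\alpha+\beta\notin\Delta_+$), $\mathfrak n=\bigoplus_{\alpha\in\Delta_+}\mathbb Cx_\alpha$, $\bar{\mathfrak n}=\mathfrak n\otimes\mathbb C[t,t^{-1}]\subset\widehat{\mathfrak g}$ (untwisted affine algebra with fundamental weights $\Lambda_0,\dots,\Lambda_n$), $x_\alpha(m)=x_\alpha\otimes t^m$, $\bar{\mathfrak n}_+=\mathfrak n\otimes\mathbb C[t]$. For $\Lambda=\sum k_j\Lambda_j$ put $\bar\Lambda=\sum_{j\ge1}k_j\lambda_j$.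 Completion: let $M$ be the free monoid on $\mathbb Z\times\Delta_+$ (words $a=((m_1,\beta_1),\dots,(m_p,\beta_p))$, concatenation $\circ$); write $a\le j$ if $m_l+\cdots+m_p\le j$ for all $l$. $F$ is the algebra of functions $\mu:M\to\mathbb C$ with $\{a\le j:\mu(a)\neq0\}$ finite for all $j$, product $(\mu_1\mu_2)(a)=\sum_{a=b\circ c}\mu_1(b)\mu_2(c)$; $X_\beta(m)$ is the indicator of the one-letter word, $X(a)=X_{\beta_1}(m_1)\cdots X_{\beta_p}(m_p)$, $\mu=\sum_a\mu(a)X(a)$. $\widetilde I$ is the two-sided ideal of $F$ generated by $X_\alpha(m)X_\beta(l)-X_\beta(l)X_\alpha(m)-C_{\alpha,\beta}X_{\alpha+\beta}(m+l)$; $\widetilde{U(\bar{\mathfrak n})}=F/\widetilde I$, $[\mu]$ the class of $\mu$, $\iota:U(\bar{\mathfrak n})\to\widetilde{U(\bar{\mathfrak n})}$ the homomorphism $x_\beta(m)\mapsto[X_\beta(m)]$, and $x_\beta(m)$ also denotes $[X_\beta(m)]$. $M_+$ is the set of words with $p\ge1$ and $m_l+\cdots+m_p\ge0$ for some $l$; $\widetilde{U(\bar{\mathfrak n})\bar{\mathfrak n}_+}=\{[\mu]:\mu(a)=0\text{ for }a\notin M_+\}$. For a sequence $(m_1,\dots,m_{k+1})$ whose distinct values have multiplicities $n_1,\dots,n_j$, $c_{m_1,\dots,m_{k+1}}=(k+1)!/(n_1!\cdots n_j!)$. $R^i_{-1,t}=\sum_{m_1+\cdots+m_{k+1}=-t,\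 m_l\le-1}x_{\alpha_i}(m_1)\cdots x_{\alpha_i}(m_{k+1})\in U(\bar{\mathfrak n})$; $\mathcal R^i_t=\iota(R^i_{-1,t})+\sum_{m_1\le\cdots\le m_{k+1},\ \sum m_l=-t,\ m_{k+1}\ge0}c_{m_1,\dots,m_{k+1}}x_{\alpha_i}(m_1)\cdots x_{\alpha_i}(m_{k+1})\in\widetilde{U(\bar{\mathfrak n})}$. $\mathcal J$ is the two-sided ideal of $\widetilde{U(\bar{\mathfrak n})}$ generated by $\mathcal R^i_t$, $i=1,\dots,n$, $t\ge k+1$. $I_{k\Lambda_0}=\sum_{i=1}^n\sum_{t\ge k+1}U(\bar{\mathfrak n})R^i_{-1,t}+U(\bar{\mathfrak n})\bar{\mathfrak n}_+$ and $I_\Lambda=I_{k\Lambda_0}+\sum_{\alpha\in\Delta_+}U(\bar{\mathfrak n})x_\alpha(-1)^{k+1-\langle\alpha,\bar\Lambda\rangle}$ (left ideals of $U(\bar{\mathfrak n})$). ''$A\equiv B$ modulo $\widetilde{U(\bar{\mathfrak n})\bar{\mathfrak n}_+}$'' in the paper is rendered as equality of the sums with $\widetilde{U(\bar{\mathfrak n})\bar{\mathfrak n}_+}$. *)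

(* Defs.v *)
From mathcomp Require Import all_boot all_order all_algebra.
From mathcomp Require Import Rstruct complex.
Set Implicit Arguments. Unset Strict Implicit. Unset Printing Implicit Defensive.
Import Order.TTheory GRing.Theory Num.Theory.
Local Open Scope ring_scope.

Definition CC : fieldType := complex.complex Rdefinitions.R.

(* Positive roots of sl(n+1): the pair (i,j), 0 <= i <= j < n, stands for
   alpha_{i+1} + ... + alpha_{j+1}; its root vector is the matrix unit
   E_{i, j+1} (rows/columns indexed 0..n). *)
Definition posroot (n : nat) := {p : 'I_n * 'I_n | (p.1 <= p.2)%N}.
Definition rlo n (a : posroot n) : nat := (val a).1.
Definition rhi n (a : posroot n) : nat := (val a).2.
Definition sroot n (i : 'I_n) : posroot n := exist _ (i, i) (leqnn i).

(* [x_a, x_b] = C_{a,b} x_{a+b} for the matrix units: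
   [E_{i,j+1}, E_{i',j'+1}] = d_{j+1,i'} E_{i,j'+1} - d_{j'+1,i} E_{i',j+1}. *)
Definition Cst n (a b : posroot n) : CC :=
  if (rhi a).+1 == rlo b then 1 else if (rhi b).+1 == rlo a then -1 else 0.
Definition rootsum n (a b : posroot n) : option (posroot n) :=
  if (rhi a).+1 == rlo b then (insub ((val a).1, (val b).2) : option (posroot n))
  else if (rhi b).+1 == rlo a then (insub ((val b).1, (val a).2) : option (posroot n))
  else None.

Definition letter n := (int * posroot n)%type.
Definition word n := seq (letter n).
Definition fn n := word n -> CC.

Definition word_le n (j : int) (a : word n) : Prop :=
  forall l, (l < size a)%N -> \sum_(x <- drop l a) x.1 <= j.

Definition inF n (mu : fn n) : Prop :=
  forall j : int, exists s : seq (word n),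
    forall a, word_le j a -> mu a != 0 -> a \in s.

(* finitely supported functions = the free algebra on the x_beta(m) *)
Definition finsupp n (mu : fn n) : Prop :=
  exists s : seq (word n), forall a, mu a != 0 -> a \in s.

Definition zeroF n : fn n := fun _ => 0.
Definition addF n (mu nu : fn n) : fn n := fun a => mu a + nu a.
Definition scaleF n (c : CC) (mu : fn n) : fn n := fun a => c * mu a.
Definition mulF n (mu nu : fn n) : fn n :=
  fun a => \sum_(i < (size a).+1) mu (take i a) * nu (drop i a).
Definition Xw n (a : word n) : fn n := fun b => (b == a)%:R.
Definition Xl n (b : posroot n) (m : int) : fn n := Xw [:: (m, b)].

Definition relgen n (a b : posroot n) (m l : int) : fn n :=
  addF (addF (Xw [:: (m, a); (l, b)]) (scaleF (-1) (Xw [:: (l, b); (m, a)])))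
       (scaleF (-1) (match rootsum a b with
                     | Some g => scaleF (Cst a b) (Xl g (m + l))
                     | None => @zeroF n end)).
Definition relgens n (mu : fn n) : Prop :=
  exists a b m l, mu = relgen a b m l.

Inductive ideal2 n (S : fn n -> Prop) : fn n -> Prop :=
| ideal2_0 : ideal2 S (@zeroF n)
| ideal2_add f g h r : inF f -> S g -> inF h -> ideal2 S r ->
    ideal2 S (addF (mulF (mulF f g) h) r).

(* image under iota of the left ideal of U(nbar) generated by (lifts of) S:
   finite sums of u * s with u in the free algebra *)
Inductive lidealT n (S : fn n -> Prop) : fn n -> Prop :=
| lidealT_0 : lidealT S (@zeroF n)
| lidealT_add t g r : finsupp t -> S g -> lidealT S r ->
    lidealT S (addF (mulF t g) r).

Definition Itil n : fn n -> Prop := ideal2 (@relgens n).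

Definition plusS n (A B : fn n -> Prop) : fn n -> Prop :=
  fun mu => exists a b, A a /\ B b /\ mu =1 addF a b.
Definition unionS n (A B : fn n -> Prop) : fn n -> Prop :=
  fun mu => A mu \/ B mu.

(* Equality of the images of A and B in U~ = F / I~, i.e. A + I~ = B + I~. *)
Definition eq_mod_Itil n (A B : fn n -> Prop) : Prop :=
  forall mu, plusS A (@Itil n) mu <-> plusS B (@Itil n) mu.

(* M_+ and (a lift to F of) U~(nbar) nbar_+ *)
Definition Mplus n (a : word n) : bool :=
  (0 < size a)%N &&
  has (fun l => 0 <= \sum_(x <- drop l a) x.1) (iota 0 (size a)).
Definition Nplus n (mu : fn n) : Prop :=
  inF mu /\ forall a, ~~ Mplus a -> mu a = 0.

(* R^i_{-1,t} (a finite sum of monomials; lifted to the free algebra) *)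
Definition Rm1 n (k : nat) (i : 'I_n) (t : nat) : fn n := fun a =>
  ((size a == k.+1) && all (fun x => (x.2 == sroot i) && (x.1 <= -1)) a
   && (\sum_(x <- a) x.1 == - (t%:Z)))%:R.

Definition mcoef (s : seq int) : nat :=
  ((size s)`! %/ \prod_(x <- undup s) (count_mem x s)`!)%N.

(* the element curly-R^i_t of F (a lift of the class in U~) *)
Definition Rcal n (k : nat) (i : 'I_n) (t : nat) : fn n := fun a =>
  Rm1 k i t a +
  (if [&& size a == k.+1, all (fun x => x.2 == sroot i) a,
          sorted <=%R (map fst a), \sum_(x <- a) x.1 == - (t%:Z)
        & 0 <= last 0 (map fst a)]
   then (mcoef (map fst a))%:R else 0).

Definition Rcalgens n (k : nat) (mu : fn n) : Prop :=
  exists (i : 'I_n) (t : nat), (k.+1 <= t)%N /\ mu = Rcal k i t.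
Definition Jid n (k : nat) : fn n -> Prop := ideal2 (Rcalgens k).

Definition IkL0gens n (k : nat) (mu : fn n) : Prop :=
  (exists (i : 'I_n) (t : nat), (k.+1 <= t)%N /\ mu = Rm1 k i t)
  \/ (exists (b : posroot n) (m : int), 0 <= m /\ mu = Xl b m).

Definition pairLam n (kk : 'I_n.+1 -> nat) (a : posroot n) : nat :=
  (\sum_(s < n.+1 | (rlo a < s <= (rhi a).+1)%N) kk s)%N.
Definition Lamgens n (k : nat) (kk : 'I_n.+1 -> nat) (mu : fn n) : Prop :=
  exists a : posroot n, mu = Xw (nseq (k.+1 - pairLam kk a) (-1, a)).

(* Main.v *)
(* Both sides are compared in V = F / (N_+ + I~), where N_+ is the left ideal of F
   of functions supported on M_+.  Modulo N_+ every element of F is a finite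
   combination of words, so no infinite family of commutation relations is ever
   used, although I~ is not topologically closed.  In V the class of the element
   curly-R^i_t is that of its finite part R^i_(-1,t), and it suffices to see that
   curly-R^i_t X(a) lies in the left ideal for every word a.  Write curly-R^i_t as
   a mode of the product of k+1 copies of x_(alpha_i)(z).  Iterated brackets with
   root vectors only produce products of fields x_g(z) with g in the pairwise
   commuting set of roots containing alpha_i, and the bracket of the mode of index
   t with x_b(l) depends on t - l only.  Hence it may be computed with l = 0,
   where x_b(0) kills the vacuum: all brackets map the vacuum into the left ideal,
   and induction on a concludes. *)
Require Import Defs.
From HB Require Import structures.
From mathcomp Require Import all_boot all_order all_algebra ring_quotient.
From mathcomp Require Import boolp classical_sets functions cardinality fsbigop.
From mathcomp Require Import zify.
Set Implicit Arguments. Unset Strict Implicit. Unset Printing Implicit Defensive.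
Import Order.TTheory GRing.Theory Num.Theory.
Local Open Scope ring_scope.

(** * Integer sequences and words *)

Definition irange (lo hi : int) : seq int :=
  if lo <= hi then [seq lo + i%:Z | i <- iota 0 `|hi - lo|.+1] else [::].

Lemma mem_irange lo hi m : (m \in irange lo hi) = (lo <= m <= hi).
Proof.
rewrite /irange; case: ifPn => h; last by rewrite in_nil; apply/esym; lia.
apply/mapP/idP => [[i]|hm]; first by rewrite mem_iota => hi' ->; lia.
by exists `|m - lo|%N; rewrite ?mem_iota; lia.
Qed.

(** The lower limit for the first entry is forced: the other [r'] entries are at most [N], so a
    total of [- t] requires [m >= - t - N *+ r']. This makes the enumeration finite. *)
Fixpoint box_rec (r : nat) (t N : int) : seq (seq int) :=
  if r is r'.+1 then
    [seq m :: s | m <- irange (- t - N *+ r') N, s <- box_rec r' (t + m) N]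
  else if t == 0 then [:: [::]] else [::].
Definition box r t N := undup (box_rec r t N).

Lemma sum_le_bound (s : seq int) N :
  all (fun x => x <= N) s -> \sum_(x <- s) x <= N *+ size s.
Proof.
elim: s => [|x s IH] /=; first by rewrite big_nil.
by move=> /andP[hx /IH hs]; rewrite big_cons mulrS lerD.
Qed.

Lemma mem_box r t N s :
  (s \in box r t N) =
    [&& size s == r, \sum_(x <- s) x == - t & all (fun x => x <= N) s].
Proof.
rewrite mem_undup; elim: r t s => [|r IH] t s /=.
  case: s => [|x s]; last by case: ifP => _; rewrite ?in_nil // inE.
  rewrite big_nil; have -> : (0 == - t) = (t == 0) by lia.
  by case: ifP.
apply/allpairsPdep/idP => [[m [s' []]]|].
  rewrite mem_irange IH => /andP[_ hm] /and3P[/eqP hs /eqP hsum ha] ->.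
  by rewrite /= hs eqxx big_cons hsum hm ha andbT /=; apply/eqP; lia.
case: s => [|m s] //=; rewrite eqSS big_cons.
move=> /and3P[/eqP hs /eqP hsum /andP[hm ha]]; exists m, s; split => //.
  have := sum_le_bound ha; rewrite hs mem_irange hm andbT => h.
  by rewrite lerBlDr -hsum lerD2l.
by rewrite IH hs eqxx ha andbT opprD -hsum addrC addKr eqxx.
Qed.

Lemma box_uniq r t N : uniq (box r t N).
Proof. exact: undup_uniq. Qed.

Definition sumset (r : nat) (t : int) : set (seq int) :=
  [set s | size s = r /\ \sum_(x <- s) x = - t].

(** Vanishing off the box provides the finite support that a sum over the infinite set [sumset r t]
    requires. Every admissible [N] gives the same value, so the bound can be chosen to suit each
    computation. *)
Lemma fsum_box (V : zmodType) r t N (F : seq int -> V) :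
  (forall s, sumset r t s -> ~~ all (fun x => x <= N) s -> F s = 0) ->
  \sum_(s \in sumset r t) F s = \sum_(s <- box r t N) F s.
Proof.
have mem_sumset s : s \in box r t N -> sumset r t s.
  by rewrite mem_box => /and3P[/eqP ? /eqP ? _].
move=> hF; transitivity (\sum_(s <- box r t N | s \in sumset r t) F s).
  apply: fsbigE => [|s|s hs]; [exact: box_uniq | exact: mem_sumset |].
  rewrite mem_box => hn; apply: hF => //.
  by case: hs hn => -> ->; rewrite !eqxx.
rewrite big_seq_cond [RHS]big_seq; apply: eq_bigl => s.
by apply: andb_idr => hs; rewrite inE; exact: mem_sumset.
Qed.

(** Models the effect on indices of a bracket with [x_b(l)]: the letter of index [m] at position [j]
    becomes one of index [m + l]. *)
Fixpoint incr (l : int) (j : nat) (s : seq int) : seq int :=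
  match s, j with
  | [::], _ => [::]
  | x :: s', 0%N => x + l :: s'
  | x :: s', j'.+1 => x :: incr l j' s'
  end.

Lemma size_incr l j s : size (incr l j s) = size s.
Proof. by elim: s j => [|x s IH] [|j] //=; rewrite IH. Qed.

Lemma sum_incr l j s : (j < size s)%N ->
  \sum_(x <- incr l j s) x = \sum_(x <- s) x + l.
Proof.
elim: s j => [|x s IH] [|j] //= hj; rewrite !big_cons; first by rewrite addrAC.
by rewrite IH // addrA.
Qed.

Lemma incrK l j : cancel (incr l j) (incr (- l) j).
Proof. by move=> s; elim: s j => [|x s IH] [|j] //=; rewrite ?addrK ?IH. Qed.

(** The inverse shifts by [- l]. This is why a bracket with [x_b(l)] turns a full mode of index [t]
    into full modes of index [t - l]. *)
Lemma sumset_incr_bij r t l j : (j < r)%N ->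
  set_bij (sumset r t) (sumset r (t - l)) (incr l j).
Proof.
move=> hj; split=> [s [hs ht]|s s' _ _ /(congr1 (incr (- l) j))|s [hs ht]].
- by split; rewrite ?size_incr // sum_incr ?hs // ht; lia.
- by rewrite !incrK.
- exists (incr (- l) j s); last by rewrite -{1}[l]opprK incrK.
  by split; rewrite ?size_incr // sum_incr ?hs // ht; lia.
Qed.

Lemma all_incr_le l j s N : all (fun x => x <= N) (incr l j s) ->
  all (fun x => x <= N + `|l|) s.
Proof.
elim: s j => [|x s IH] [|j] //= /andP[hx hs].
  apply/andP; split; first by lia.
  by apply: sub_all hs => y; lia.
by rewrite (IH j) // andbT; lia.
Qed.

(** * Degrees of words and the set M_+ *)

Definition deg n (a : word n) : int := \sum_(x <- a) x.1.

Lemma deg_cat n (a b : word n) : deg (a ++ b) = deg a + deg b.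
Proof. by rewrite /deg big_cat. Qed.

Lemma MplusP n (a : word n) :
  reflect (exists b c, [/\ a = b ++ c, c != [::] & 0 <= deg c]) (Mplus a).
Proof.
apply: (iffP andP) => [[_ /hasP[l]]|[b [c [-> hc hd]]]].
  rewrite mem_iota => /andP[_ hl] hd; exists (take l a), (drop l a).
  by split; rewrite ?cat_take_drop // -size_eq0 size_drop subn_eq0 -ltnNge.
rewrite -size_eq0 -lt0n in hc; split; first by rewrite size_cat addn_gt0 hc orbT.
apply/hasP; exists (size b); last by rewrite drop_size_cat.
by rewrite mem_iota size_cat /= add0n -[ltnLHS]addn0 ltn_add2l.
Qed.

Lemma Mplus_catr n (p a : word n) : Mplus a -> Mplus (p ++ a).
Proof.
move=> /MplusP[b [c [-> hc hd]]]; apply/MplusP; exists (p ++ b), c.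
by rewrite catA.
Qed.

Lemma Mplus_suffix n (p a : word n) : a != [::] -> 0 <= deg a -> Mplus (p ++ a).
Proof. by move=> ha hd; apply/MplusP; exists p, a. Qed.

(** * Roots whose support contains a fixed simple root *)

Definition through n (i : nat) (a : posroot n) : bool := (rlo a <= i <= rhi a)%N.

(** An integer counterpart of [Cst], able to act on any [zmodType]. The value -1 is meaningful only
    when [rootsum a b] is a root. *)
Definition csign n (a b : posroot n) : int :=
  if (rhi a).+1 == rlo b then 1 else -1.

(** The sum would contain the simple root with coefficient 2, which no root of type A does. Hence
    these root vectors commute pairwise. *)
Lemma rootsum_through n i (a b : posroot n) :
  through i a -> through i b -> rootsum a b = None.
Proof.
rewrite /through /rootsum => ha hb.
by case: eqP => [h|_]; [lia | case: eqP => // h; lia].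
Qed.

(** Adding a positive root never removes a simple root from the support, so the commuting family is
    stable under brackets with all of n. *)
Lemma through_rootsum n i (a b g : posroot n) :
  through i a -> rootsum a b = Some g -> through i g.
Proof.
have hb : (rlo b <= rhi b)%N by exact: (valP b).
rewrite /rootsum /through => ha; case: eqP => [h|_].
  by case: insubP => // u _ hu [<-]; move: ha h hb; rewrite /rlo /rhi hu /=; lia.
case: eqP => // h.
by case: insubP => // u _ hu [<-]; move: ha h hb; rewrite /rlo /rhi hu /=; lia.
Qed.

(** * Straightening *)

(* The terms of [x_G, x_b] by the Leibniz rule: [(sign, j, G')], where [G'] is
   [G] with [b] added to its [j]-th root. *)
Fixpoint ad_roots n (b : posroot n) (G : seq (posroot n)) :
    seq (int * nat * seq (posroot n)) :=
  if G is g :: G' then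
    (if rootsum g b is Some h then [:: (csign g b, 0%N, h :: G')] else [::])
    ++ [seq (d.1.1, d.1.2.+1, g :: d.2) | d <- ad_roots b G']
  else [::].

Lemma ad_rootsP n i (b : posroot n) G d : d \in ad_roots b G ->
  [/\ (d.1.2 < size G)%N, size d.2 = size G
    & all (through i) G -> all (through i) d.2].
Proof.
elim: G d => [|g G IH] d //=; rewrite mem_cat => /orP[|/mapP[e /IH[h1 h2 h3] ->]] /=.
  case E: rootsum => [h|] //; rewrite inE => /eqP-> /=; split => //.
  by move=> /andP[hg ->]; rewrite (through_rootsum hg E).
by split; rewrite ?h2 // => /andP[-> /h3].
Qed.

Section Straightening.
Variables (n : nat) (V : zmodType) (w : word n -> V).
(** [w] abstracts the class of a word modulo [Nplus] and [Itil]. Straightening then consists of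
    finite sums in an abelian group, governed by the commutation relation and the vanishing on
    M_+. *)
Hypothesis w_comm : forall p q m l a b,
  w (p ++ [:: (m, a), (l, b) & q]) = w (p ++ [:: (l, b), (m, a) & q]) +
  (if rootsum a b is Some g then w (p ++ (m + l, g) :: q) *~ csign a b else 0).
Hypothesis w_Mplus : forall a, Mplus a -> w a = 0.
Variable i : nat.

Let thr (x : letter n) := through i x.2.

Lemma w_swap_letter x S p q : thr x -> all thr S ->
  w (p ++ x :: S ++ q) = w (p ++ S ++ x :: q).
Proof.
move=> hx; elim: S p => [|y S IH] p //= /andP[hy hS].
case: x y hx hy IH => m a [l b] hx hy IH; rewrite w_comm (rootsum_through hx hy) addr0.
by rewrite -cat_rcons IH // cat_rcons.
Qed.

Lemma w_swap_block S1 S2 p q : all thr S1 -> all thr S2 ->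
  w (p ++ S1 ++ S2 ++ q) = w (p ++ S2 ++ S1 ++ q).
Proof.
elim: S1 p => [|x S1 IH] p //= /andP[hx h1] h2.
by rewrite -cat_rcons IH // cat_rcons w_swap_letter.
Qed.

Lemma w_perm S1 S2 p q : all thr S1 -> perm_eq S1 S2 ->
  w (p ++ S1 ++ q) = w (p ++ S2 ++ q).
Proof.
move=> h1 h12; pose P S := all thr S /\ w (p ++ S1 ++ q) = w (p ++ S ++ q).
suff [] : P S2 by [].
apply: (catCA_perm_ind _ h12); last by [].
move=> s1 s2 s3; rewrite /P !all_cat => -[/and3P[hs1 hs2 hs3] ->].
by rewrite hs1 hs2 hs3 -!catA w_swap_block.
Qed.

(** The letters of [S] commute, so [x] can be moved next to [a]; the suffix [x :: a] then has
    nonnegative degree. *)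
Lemma w_large S p a x : all thr S -> x \in S -> 0 <= x.1 + deg a ->
  w (p ++ S ++ a) = 0.
Proof.
move=> hS hx hd; have h : perm_eq S (rem x S ++ [:: x]).
  by apply: perm_trans (perm_to_rem hx) _; rewrite perm_sym perm_catC.
rewrite (w_perm p a hS h) -[_ ++ a]catA catA w_Mplus // Mplus_suffix //.
by rewrite deg_cat {1}/deg big_seq1.
Qed.

Lemma zip_thr s G : all (through i) G -> all thr (zip s G).
Proof. by elim: G s => [|g G IH] [|x s] //= /andP[hg /IH ->]; rewrite /thr hg. Qed.

(** An entry exceeding [N] is at least [N + 1], which explains the 1 in the bound. *)
Lemma w_zip_large s G p a N : size s = size G -> all (through i) G ->
  0 <= N + 1 + deg a -> ~~ all (fun x => x <= N) s ->
  w (p ++ zip s G ++ a) = 0.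
Proof.
move=> hs hG hN /allPn[m hm hmN].
have [x hx hxm] : exists2 x, x \in zip s G & x.1 = m.
  have h : m \in unzip1 (zip s G) by rewrite unzip1_zip ?hs.
  by case/mapP: h => x hx ->; exists x.
apply: (w_large p (zip_thr s hG) hx).
by rewrite hxm; lia.
Qed.

(** Leibniz rule: [(l, b)] passes the letters of the block one at a time, and each passage leaves
    the bracket term recorded in [ad_roots]. *)
Lemma w_zip_comm s G p l b a : size s = size G ->
  w (p ++ zip s G ++ (l, b) :: a) = w (p ++ (l, b) :: zip s G ++ a) +
  \sum_(d <- ad_roots b G) w (p ++ zip (incr l d.1.2 s) d.2 ++ a) *~ d.1.1.
Proof.
elim: G s p => [|g G IH] [|m s] //= p; first by rewrite big_nil addr0.
move=> [hs]; rewrite -cat_rcons IH // cat_rcons w_comm -addrA; congr (_ + _).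
rewrite big_cat big_map; congr (_ + _).
  by case: rootsum => [h|]; rewrite ?big_nil // big_seq1.
by apply: eq_bigr => d _; rewrite cat_rcons.
Qed.

(* The mode of index [- t] of the product of the fields [x_g(z)], [g] in [G].  The
   support is finite when all roots of [G] contain [i]: a letter with large
   index can then be moved to the right end, next to [a]. *)
Definition mode (t : int) (p : word n) (G : seq (posroot n)) (a : word n) : V :=
  \sum_(s \in sumset (size G) t) w (p ++ zip s G ++ a).

Lemma mode_box (N t : int) p G a : all (through i) G -> 0 <= N + 1 + deg a ->
  mode t p G a = \sum_(s <- box (size G) t N) w (p ++ zip s G ++ a).
Proof.
move=> hG hN; apply: fsum_box => s [hs _]; exact: w_zip_large.
Qed.

(** The box bounds [s] while the vanishing criterion applies to [incr l j s], whose entries may be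
    smaller by up to [|l|]; hence the slack in the bound. *)
Lemma mode_incr_box (N t l : int) j p G a : all (through i) G -> (j < size G)%N ->
  0 <= N - `|l| + 1 + deg a ->
  mode (t - l) p G a = \sum_(s <- box (size G) t N) w (p ++ zip (incr l j s) G ++ a).
Proof.
move=> hG hj hN; rewrite /mode (reindex_fsbig _ _ _ _ (sumset_incr_bij t l hj)).
apply: fsum_box => s [hs _] hn; apply: (w_zip_large _ _ hG hN).
  by rewrite size_incr.
by apply: contra hn => /all_incr_le; rewrite subrK.
Qed.

Lemma mode_comm t p G l b a : all (through i) G ->
  mode t p G ((l, b) :: a) = mode t (rcons p (l, b)) G a +
  \sum_(d <- ad_roots b G) mode (t - l) p d.2 a *~ d.1.1.
Proof.
(* One truncation must serve all three kinds of sum: with suffix [(l, b) :: a], with suffix [a], and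
   with one index shifted by [l]. *)
move=> hG; pose N : int := `|l| + `|deg a|.
have hd : deg ((l, b) :: a) = l + deg a by rewrite /deg big_cons.
rewrite (@mode_box N) ?hd //; last by rewrite /N; lia.
rewrite (@mode_box N t _ _ a) //; last by rewrite /N; lia.
transitivity (\sum_(s <- box (size G) t N) (w (rcons p (l, b) ++ zip s G ++ a) +
   \sum_(d <- ad_roots b G) w (p ++ zip (incr l d.1.2 s) d.2 ++ a) *~ d.1.1)).
  apply: eq_big_seq => s; rewrite mem_box => /and3P[/eqP hs _ _].
  by rewrite w_zip_comm // cat_rcons.
rewrite big_split /=; congr (_ + _).
rewrite exchange_big; apply: eq_big_seq => d /(ad_rootsP i)[h1 h2 h3].
rewrite -mulrz_suml -h2; congr (_ *~ _); apply/esym/mode_incr_box; rewrite ?h2 ?h3 //.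
by rewrite /N; lia.
Qed.

(* [Th] is a formal integral combination of lists of roots. *)
Definition modes (t : int) (p : word n) (Th : seq (int * seq (posroot n)))
    (a : word n) : V := \sum_(c <- Th) mode t p c.2 a *~ c.1.

(** The roots and signs produced by a bracket with [x_b(l)]. They do not depend on [l], which
    affects only the index of the mode. *)
Definition ad_comb (b : posroot n) (Th : seq (int * seq (posroot n))) :=
  [seq (d.1.1 * c.1, d.2) | c <- Th, d <- ad_roots b c.2].

Lemma modes_comm t p Th l b a : all (fun c => all (through i) c.2) Th ->
  modes t p Th ((l, b) :: a) = modes t (rcons p (l, b)) Th a + modes (t - l) p (ad_comb b Th) a.
Proof.
move=> hTh; rewrite /modes big_allpairs_dep -big_split; apply: eq_big_seq => c hc /=.
rewrite mode_comm ?(allP hTh _ hc) // mulrzDl; congr (_ + _).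
by rewrite mulrz_suml; apply: eq_bigr => d _; rewrite mulrzA.
Qed.

Lemma ad_comb_through b Th : all (fun c => all (through i) c.2) Th ->
  all (fun c => all (through i) c.2) (ad_comb b Th).
Proof.
move=> hTh; apply/allP => _ /allpairsPdep[c [d [hc hd ->]]] /=.
by have [_ _] := ad_rootsP i hd; apply; exact: (allP hTh).
Qed.

(** To be instantiated by the image of the left ideal. Left multiplication is carried by the prefix
    [p], over which the statements quantify, so [W] is asked only to be closed under sums and
    opposites. *)
Variable W : V -> Prop.
Hypothesis W_add : forall x y, W x -> W y -> W (x + y).
Hypothesis W_opp : forall x, W x -> W (- x).

Lemma mode_nonneg t p G m b : 0 <= m -> mode t p G [:: (m, b)] = 0.
Proof.
move=> hm; apply: fsbig1 => s _; rewrite catA w_Mplus // Mplus_suffix //.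
by rewrite /deg big_seq1.
Qed.

(* A commutator with [x_b(l)] depends only on [t - l], so it may be computed
   with [l = 0], where [x_b(0)] annihilates the vacuum on the right. *)
Lemma modes_mem Th a : all (fun c => all (through i) c.2) Th ->
  (forall t p, W (modes t p Th [::])) -> forall t p, W (modes t p Th a).
Proof.
elim: a Th => [|[l b] a IH] Th hTh hW t p //.
rewrite modes_comm //; apply: W_add; first exact: IH.
apply: IH; first exact: ad_comb_through.
move=> t' p'; have := modes_comm t' p' 0 b [::] hTh; rewrite subr0.
have -> : modes t' p' Th [:: (0, b)] = 0.
  by rewrite /modes big1 // => c _; rewrite mode_nonneg ?mul0rz.
move=> h; have -> : modes t' p' (ad_comb b Th) [::] = - modes t' (rcons p' (0, b)) Th [::].
  by apply/eqP; rewrite -addr_eq0 addrC -h.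
exact: W_opp.
Qed.

End Straightening.

(** * The algebra F and its subspaces *)

HB.instance Definition _ n := GRing.Lmodule.copy (fn n) (word n -> CC^o).

Section FreeAlgebra.
Variable n : nat.
Implicit Types (f g h mu : fn n) (a b c p : word n).

Lemma addFE f g : addF f g = f + g. Proof. by []. Qed.
Lemma scaleFE x f : scaleF x f = x *: f. Proof. by []. Qed.
Lemma zeroFE : @zeroF n = 0. Proof. by []. Qed.

Lemma mulF_cons f g x a :
  mulF f g (x :: a) = f [::] * g (x :: a) + mulF (fun b => f (x :: b)) g a.
Proof. by rewrite /mulF big_ord_recl. Qed.

Lemma mulF_nil f g : mulF f g [::] = f [::] * g [::].
Proof. by rewrite /mulF big_ord1. Qed.

Lemma mulFDl f1 f2 g : mulF (f1 + f2) g = mulF f1 g + mulF f2 g.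
Proof.
apply/funext => a; rewrite /mulF -[RHS]big_split; apply: eq_bigr => i _.
exact: mulrDl.
Qed.

Lemma mulFDr f g1 g2 : mulF f (g1 + g2) = mulF f g1 + mulF f g2.
Proof.
apply/funext => a; rewrite /mulF -[RHS]big_split; apply: eq_bigr => i _.
exact: mulrDr.
Qed.

Lemma mulFZl x f g : mulF (x *: f) g = x *: mulF f g.
Proof.
apply/funext => a; rewrite /mulF -[RHS]/(x * _) mulr_sumr; apply: eq_bigr => i _.
by rewrite mulrA.
Qed.

Lemma mulFZr x f g : mulF f (x *: g) = x *: mulF f g.
Proof.
apply/funext => a; rewrite /mulF -[RHS]/(x * _) mulr_sumr; apply: eq_bigr => i _.
by rewrite mulrCA.
Qed.

Lemma mul0F f : mulF 0 f = 0.
Proof. by have := mulFZl 0 0 f; rewrite !scale0r. Qed.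

Lemma mulF0 f : mulF f 0 = 0.
Proof. by have := mulFZr 0 f 0; rewrite !scale0r. Qed.

Lemma mulF_suml I (r : seq I) (F : I -> fn n) g :
  mulF (\sum_(i <- r) F i) g = \sum_(i <- r) mulF (F i) g.
Proof.
by elim: r => [|i r IH]; rewrite ?big_nil ?mul0F // !big_cons mulFDl IH.
Qed.

Lemma mulF_sumr I (r : seq I) (F : I -> fn n) f :
  mulF f (\sum_(i <- r) F i) = \sum_(i <- r) mulF f (F i).
Proof.
by elim: r => [|i r IH]; rewrite ?big_nil ?mulF0 // !big_cons mulFDr IH.
Qed.

(** Induction on the word, peeling off the first letter. [f] is generalized because each step
    replaces it by the shifted function [b |-> f (x :: b)]. *)
Lemma mulFA f g h : mulF (mulF f g) h = mulF f (mulF g h).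
Proof.
apply/funext => a; elim: a f g => [|x a IH] f g.
  by rewrite !mulF_nil mulrA.
rewrite !mulF_cons mulF_nil.
have -> : (fun b => mulF f g (x :: b)) =
    f [::] *: ((fun b => g (x :: b)) : fn n) + mulF (fun b => f (x :: b)) g.
  by apply/funext => b; rewrite mulF_cons.
rewrite mulFDl mulFZl -IH mulrDr -!addrA; congr (_ + _); first by rewrite mulrA.
Qed.

Lemma mulF_neq0 f g a : mulF f g a != 0 ->
  exists b c, [/\ a = b ++ c, f b != 0 & g c != 0].
Proof.
move=> h; case: (boolP [exists i : 'I_(size a).+1, f (take i a) * g (drop i a) != 0]).
  move=> /existsP[i]; rewrite mulf_eq0 negb_or => /andP[h1 h2].
  by exists (take i a), (drop i a); rewrite cat_take_drop.
rewrite negb_exists => /forallP h0; case/eqP: h; apply: big1 => i _.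
by apply/eqP; have := h0 i; rewrite negbK.
Qed.

Lemma Xw_neq0 a b : Xw a b != 0 -> b = a.
Proof. by rewrite /Xw; have [//|_] := eqVneq b a; rewrite eqxx. Qed.

Lemma mulF1 f : mulF f (Xw [::]) = f.
Proof.
apply/funext => a; elim: a f => [|x a IH] f; first by rewrite mulF_nil /Xw eqxx mulr1.
by rewrite mulF_cons IH /Xw mulr0 add0r.
Qed.

Lemma mulXw a b : mulF (Xw a) (Xw b) = Xw (a ++ b).
Proof.
apply/funext => c; elim: c a => [|x c IH] a.
  by rewrite mulF_nil /Xw; case: a => [|y a]; rewrite ?mul1r // mul0r.
rewrite mulF_cons; case: a => [|y a].
  have -> : (fun b0 => Xw [::] (x :: b0)) = 0 :> fn n by [].
  by rewrite mul0F /Xw eqxx mul1r addr0.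
have -> : (fun b0 => Xw (y :: a) (x :: b0)) = (x == y)%:R *: Xw a.
  apply/funext => b0; rewrite -[RHS]/(_ * _) /Xw eqseq_cons.
  by case: eqP; rewrite ?mul1r ?mul0r.
rewrite mulFZl -[X in _ + X]/(_ * _) IH /Xw /= mul0r add0r eqseq_cons.
by case: eqP; rewrite ?mul1r ?mul0r.
Qed.

Lemma sum_Xw f (L : seq (word n)) : uniq L ->
  \sum_(a <- L) f a *: Xw a = (fun b => if b \in L then f b else 0).
Proof.
move=> uL; apply/funext => b; elim: L uL => [|a L IH] /=; first by rewrite big_nil.
move=> /andP[haL uL]; rewrite big_cons -[LHS]/(f a * Xw a b + _ b) IH // inE /Xw.
have [->|_] := eqVneq b a; last by rewrite mulr0 add0r.
by rewrite (negPf haL) mulr1 addr0.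
Qed.

(** * The finiteness condition defining F *)

Lemma word_le_cat (j : int) b c : word_le j (b ++ c) ->
  word_le (j - deg c) b /\ word_le j c.
Proof.
move=> h; split=> l hl.
  have := h l; rewrite size_cat drop_cat hl big_cat => /(_ (ltn_addr _ hl)).
  by rewrite lerBrDr.
have := h (size b + l)%N; rewrite size_cat ltn_add2l hl => /(_ isT).
by rewrite drop_cat ltnNge leq_addr addKn.
Qed.

(** Degrees are integers, so negative means at most -1. Thus [inF] at [j = -1] says that an element
    of F is a finite combination of words modulo [Nplus]. *)
Lemma word_le_Mplus a : ~~ Mplus a <-> word_le (-1) a.
Proof.
split=> [h l hl|h].
  rewrite leNgt; apply: contra h => h; rewrite -(cat_take_drop l a).
  apply: Mplus_suffix; first by rewrite -size_eq0 size_drop subn_eq0 -ltnNge.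
  by move: h; rewrite -/(deg _); lia.
apply/negP => /andP[_ /hasP[l]]; rewrite mem_iota => /andP[_ hl].
by have := h l hl; lia.
Qed.

Lemma not_word_le (j : int) a : ~ word_le j a ->
  exists b c, [/\ a = b ++ c, c != [::] & j < deg c].
Proof.
move=> /existsNP[l /not_implyP[hl /negP]]; rewrite -ltNge => h.
exists (take l a), (drop l a); split => //; first by rewrite cat_take_drop.
by rewrite -size_eq0 size_drop subn_eq0 -ltnNge.
Qed.

Lemma finsupp_inF f : finsupp f -> inF f.
Proof. by move=> [s hs] j; exists s => a _; exact: hs. Qed.

Lemma finsupp_Xw a : finsupp (Xw a).
Proof. by exists [:: a] => b /Xw_neq0 ->; rewrite inE. Qed.

Lemma inF_Xw a : inF (Xw a).
Proof. exact/finsupp_inF/finsupp_Xw. Qed.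

Lemma finsuppZ x f : finsupp f -> finsupp (x *: f).
Proof.
move=> [s hs]; exists s => a; rewrite -[_ a]/(x * f a) mulf_eq0 negb_or.
by move=> /andP[_ /hs].
Qed.

Lemma inF0 : inF (0 : fn n).
Proof. by move=> j; exists [::] => a _; rewrite eqxx. Qed.

Lemma inFZ x f : inF f -> inF (x *: f).
Proof.
move=> hf j; have [s hs] := hf j; exists s => a ha.
by rewrite -[_ a]/(x * f a) mulf_eq0 negb_or => /andP[_ /hs]; apply.
Qed.

Lemma inFD f g : inF f -> inF g -> inF (f + g).
Proof.
move=> hf hg j; have [s hs] := hf j; have [s' hs'] := hg j.
exists (s ++ s') => a ha; rewrite mem_cat -[(_ + _) a]/(f a + g a).
have [h0|/(hs _ ha) -> //] := eqVneq (f a) 0.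
by rewrite h0 add0r => /(hs' _ ha) ->; rewrite orbT.
Qed.

(** The right factor of a word bounded by [j] is itself bounded by [j], which leaves finitely many
    [c]. For each of them the left factor is bounded by [j - deg c], so finitely many [b] remain. *)
Lemma inF_mul f g : inF f -> inF g -> inF (mulF f g).
Proof.
move=> /choice[L hL] hg j; have [s hs] := hg j.
exists [seq b ++ c | c <- s, b <- L (j - deg c)] => a ha /mulF_neq0[b [c [E hb hc]]].
subst a; have [h1 h2] := word_le_cat ha.
by apply/allpairsPdep; exists c, b; split; [exact: hs | exact: hL |].
Qed.

Lemma inF_split f (L : seq (word n)) : uniq L -> inF f ->
  exists f', [/\ f = \sum_(a <- L) f a *: Xw a + f', inF f'
    & f' = (fun b => if b \in L then 0 else f b)].
Proof.
move=> uL hf; pose f' : fn n := fun b => if b \in L then 0 else f b.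
exists f'; rewrite sum_Xw //; split=> // [|j].
  apply/funext => b; rewrite -[RHS]/((if _ then _ else _) + (if _ then _ else _)).
  by case: ifP; rewrite ?addr0 ?add0r.
have [s hs] := hf j; exists s => a ha.
by rewrite /f'; case: ifP => _; [rewrite eqxx | exact: hs].
Qed.

Lemma inF_decomp f (j : int) : inF f -> exists (L : seq (word n)) f',
  [/\ f = \sum_(a <- L) f a *: Xw a + f', inF f' & forall a, word_le j a -> f' a = 0].
Proof.
move=> hf; have [s hs] := hf j.
have [f' [Ef hf' Ef']] := inF_split (undup_uniq s) hf.
exists (undup s), f'; split=> // a ha; rewrite Ef' mem_undup; case: ifPn => // hn.
by apply/eqP; apply: contraNT hn; exact: hs.
Qed.

(** * Subspaces, the left ideal N_+, and generated ideals *)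

Definition subspace (P : fn n -> Prop) :=
  P 0 /\ forall x f g, P f -> P g -> P (x *: f + g).

Section Subspace.
Variable P : fn n -> Prop.
Hypothesis hP : subspace P.

Lemma subspace0 : P 0. Proof. by case: hP. Qed.
Lemma subspaceD f g : P f -> P g -> P (f + g).
Proof. by case: hP => _ h hf hg; rewrite -[f]scale1r; exact: h. Qed.
Lemma subspaceZ x f : P f -> P (x *: f).
Proof. by case: hP => h0 h hf; rewrite -[_ *: _]addr0; exact: h. Qed.
Lemma subspaceN f : P f -> P (- f).
Proof. by rewrite -scaleN1r; exact: subspaceZ. Qed.
Lemma subspace_sum I (r : seq I) (F : I -> fn n) :
  (forall i, P (F i)) -> P (\sum_(i <- r) F i).
Proof.
move=> h; elim: r => [|i r IH]; first by rewrite big_nil; exact: subspace0.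
by rewrite big_cons; exact: subspaceD.
Qed.
End Subspace.

Lemma plusSE (P Q : fn n -> Prop) mu :
  plusS P Q mu <-> exists f g, [/\ P f, Q g & mu = f + g].
Proof.
split=> [[f [g [hf [hg h]]]]|[f [g [hf hg ->]]]]; last by exists f, g.
by exists f, g; split => //; apply/funext.
Qed.

Lemma plusSl (P Q : fn n -> Prop) : subspace Q -> forall mu, P mu -> plusS P Q mu.
Proof.
move=> hQ mu hmu; apply/plusSE; exists mu, 0; rewrite addr0.
by split => //; exact: subspace0.
Qed.

Lemma plusSr (P Q : fn n -> Prop) : subspace P -> forall mu, Q mu -> plusS P Q mu.
Proof.
move=> hP mu hmu; apply/plusSE; exists 0, mu; rewrite add0r.
by split => //; exact: subspace0.
Qed.

Lemma plusS_subspace (P Q : fn n -> Prop) :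
  subspace P -> subspace Q -> subspace (plusS P Q).
Proof.
move=> hP hQ; split; first exact/plusSl/(subspace0 hP).
move=> x f g /plusSE[f1 [f2 [h1 h2 ->]]] /plusSE[g1 [g2 [h3 h4 ->]]].
apply/plusSE; exists (x *: f1 + g1), (x *: f2 + g2).
split; [exact: (hP.2) | exact: (hQ.2) |].
by rewrite scalerDr addrACA.
Qed.

Lemma plusS_sub (P Q T : fn n -> Prop) : subspace T ->
  (forall mu, P mu -> T mu) -> (forall mu, Q mu -> T mu) ->
  forall mu, plusS P Q mu -> T mu.
Proof.
move=> hT hP hQ mu /plusSE[f [g [hf hg ->]]].
by apply: subspaceD => //; [exact: hP | exact: hQ].
Qed.

Lemma Nplus_subspace : subspace (@Nplus n).
Proof.
split=> [|x f g [hf hf0] [hg hg0]]; first by split=> //; exact: inF0.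
split=> [|a ha]; first by apply: inFD => //; exact: inFZ.
by rewrite -[LHS]/(x * f a + g a) hf0 // hg0 // mulr0 addr0.
Qed.

Lemma NplusP f : inF f -> (forall a, f a != 0 -> Mplus a) -> Nplus f.
Proof.
by move=> hf h; split=> // a; apply: contraNeq; exact: h.
Qed.

(** M_+ is defined through suffixes, hence stable under adding a prefix. *)
Lemma Nplus_mull f g : inF f -> Nplus g -> Nplus (mulF f g).
Proof.
move=> hf [hg hg0]; apply: NplusP => [|a]; first exact: inF_mul.
move=> /mulF_neq0[b [c [-> _ hc]]]; apply: Mplus_catr.
by apply: contraNT hc => /hg0 ->.
Qed.

Lemma Nplus_Xw a : Mplus a -> Nplus (Xw a).
Proof. by move=> ha; apply: NplusP => [|b /Xw_neq0 ->//]; exact: inF_Xw. Qed.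

Section Ideals.
Variable S : fn n -> Prop.

Lemma ideal2_gen f g h : inF f -> S g -> inF h -> ideal2 S (mulF (mulF f g) h).
Proof.
move=> hf hg hh; rewrite -[mulF _ _]addr0; apply: ideal2_add => //.
exact: ideal2_0.
Qed.

Lemma ideal2_subspace : subspace (ideal2 S).
Proof.
split; first exact: ideal2_0.
move=> x f g hf; elim: hf g => [|f1 g1 h1 r hf1 hg1 hh1 _ IH] g hg.
  by rewrite zeroFE scaler0 add0r.
rewrite addFE scalerDr -addrA -!mulFZl; apply: ideal2_add => //.
  exact: inFZ.
exact: IH.
Qed.

Lemma lidealT_gen t g : finsupp t -> S g -> lidealT S (mulF t g).
Proof.
move=> ht hg; rewrite -[mulF _ _]addr0; apply: lidealT_add => //.
exact: lidealT_0.
Qed.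

Lemma lidealT_subspace : subspace (lidealT S).
Proof.
split; first exact: lidealT_0.
move=> x f g hf; elim: hf g => [|f1 g1 r hf1 hg1 _ IH] g hg.
  by rewrite zeroFE scaler0 add0r.
rewrite addFE scalerDr -addrA -!mulFZl; apply: lidealT_add => //.
  exact: finsuppZ.
exact: IH.
Qed.

Lemma lidealT_sub T : subspace T ->
  (forall t g, finsupp t -> S g -> T (mulF t g)) -> forall f, lidealT S f -> T f.
Proof.
move=> hT h f; elim=> [|t g r ht hg _ hr]; first exact: subspace0.
by apply: (subspaceD hT) => //; exact: h.
Qed.

Lemma ideal2_sub T : subspace T ->
  (forall f g h, inF f -> S g -> inF h -> T (mulF (mulF f g) h)) ->
  forall f, ideal2 S f -> T f.
Proof.
move=> hT h f; elim=> [|f1 g h1 r hf hg hh _ hr]; first exact: subspace0.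
by apply: (subspaceD hT) => //; exact: h.
Qed.

End Ideals.
End FreeAlgebra.

(** * Permutations of a sequence and quotients *)

(** Elements of [L] absent from [s] contribute [0! = 1]. *)
Lemma prod_count_fact (T : eqType) (s L : seq T) : uniq L -> {subset s <= L} ->
  (\prod_(x <- L) (count_mem x s)`! = \prod_(x <- undup s) (count_mem x s)`!)%N.
Proof.
move=> uL sL; rewrite (bigID (mem s)) /= [X in (_ * X)%N]big1 => [|x hx].
  rewrite muln1 -big_filter; apply: perm_big; apply: uniq_perm.
  - exact: filter_uniq.
  - exact: undup_uniq.
  by move=> x; rewrite mem_filter mem_undup andb_idr //; exact: sL.
by rewrite (count_memPn hx).
Qed.

Lemma prod_count_rem (T : eqType) (s : seq T) x : x \in s ->
  (\prod_(y <- undup s) (count_mem y s)`! =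
   count_mem x s * \prod_(y <- undup (rem x s)) (count_mem y (rem x s))`!)%N.
Proof.
move=> hx; have hc y : count_mem y s = ((x == y) + count_mem y (rem x s))%N.
  by rewrite (permP (perm_to_rem hx)).
have hux : x \in undup s by rewrite mem_undup.
rewrite -(@prod_count_fact _ (rem x s) (undup s)) ?undup_uniq //; last first.
  by move=> y /mem_rem; rewrite mem_undup.
rewrite !(bigD1_seq x) ?undup_uniq //= mulnA hc eqxx add1n factS; congr (_ * _)%N.
by apply: eq_bigr => y hy; rewrite hc eq_sym (negPf hy).
Qed.

Lemma sum_count_undup (T : eqType) (s : seq T) :
  (\sum_(x <- undup s) count_mem x s = size s)%N.
Proof.
rewrite -sum1_size; under eq_bigr => x _ do rewrite -sum1_count big_mkcond.
rewrite exchange_big; apply: eq_big_seq => y hy /=.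
rewrite (bigD1_seq y) ?mem_undup ?undup_uniq //= eqxx big1 // => x.
by rewrite eq_sym => /negPf ->.
Qed.

(** Induction on the size: permutations starting with [x] are those of [rem x s]. Multiplied by the
    product of factorials they contribute [count_mem x s] times [(size s - 1)!], and the
    multiplicities add up to [size s]. *)
Lemma size_permutations_mult (T : eqType) (s : seq T) :
  (size (permutations s) * \prod_(x <- undup s) (count_mem x s)`! = (size s)`!)%N.
Proof.
have [m] := ubnP (size s); elim: m s => // m IH s; rewrite ltnS => hm.
have [h0|hs] := posnP (size s).
  by move/size0nil: h0 => ->; rewrite big_nil.
rewrite (perm_size (permutationsE hs)) size_allpairs_dep sumnE big_map big_distrl /=.
rewrite -[in RHS](prednK hs) factS (prednK hs) -[in RHS]sum_count_undup big_distrl /=.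
apply: eq_big_seq => x; rewrite mem_undup => hx.
rewrite (prod_count_rem hx) mulnCA IH size_rem ?sum_count_undup //.
by rewrite prednK.
Qed.

(** In particular the truncated division in [mcoef] is exact. *)
Lemma mcoefE s : mcoef s = size (permutations s).
Proof.
rewrite /mcoef -size_permutations_mult mulnK // prodn_gt0 // => x.
exact: fact_gt0.
Qed.

(** Group the sequences by their sorted rearrangement: the fibre over a sorted [u] consists of its
    [mcoef u] permutations, on which [F] is constant. *)
Lemma sum_sorted (V : zmodType) (B : seq (seq int)) (P : pred (seq int))
    (F : seq int -> V) : uniq B ->
  (forall s u, perm_eq s u -> (s \in B) = (u \in B)) ->
  (forall s u, perm_eq s u -> P s = P u) ->
  (forall s u, perm_eq s u -> F s = F u) ->
  \sum_(s <- B | P s) F s =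
  \sum_(u <- B | P u && sorted <=%R u) F u *+ mcoef u.
Proof.
move=> uB hB hP hF.
have hsort (s u : seq int) : (sort <=%R s == u) = sorted <=%R u && perm_eq s u.
  apply/eqP/andP => [<-|[hu hsu]]; first by rewrite sort_le_sorted perm_sym perm_sort.
  apply: le_sorted_eq => //; first exact: sort_le_sorted.
  by rewrite perm_sort.
transitivity (\sum_(s <- B | P s) \sum_(u <- B | sort <=%R s == u) F u).
  rewrite big_seq_cond [RHS]big_seq_cond; apply: eq_bigr => s /andP[hs _].
  have hss : perm_eq s (sort <=%R s) by rewrite perm_sym perm_sort.
  rewrite -big_filter (@perm_big _ _ _ _ _ [:: sort <=%R s]) ?big_seq1 ?(hF _ _ hss) //.
  apply: uniq_perm => //; first exact: filter_uniq.
  move=> u; rewrite mem_filter inE eq_sym.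
  by have [->|//] := eqVneq u; rewrite -(hB _ _ hss) hs.
rewrite (exchange_big_dep predT) //= [RHS]big_mkcond [LHS]big_seq [RHS]big_seq.
apply: eq_bigr => u hu.
rewrite big_const_seq iter_addr_0.
case: ifPn => [/andP[hPu hsu]|hn]; last first.
  rewrite (@eq_count _ _ pred0) ?count_pred0 // => s /=; rewrite hsort.
  by apply: contraNF hn => /and3P[hs -> /hP <-]; rewrite hs.
congr (_ *+ _); rewrite mcoefE -size_filter; apply: perm_size.
apply: uniq_perm; [exact: filter_uniq | exact: permutations_uniq |] => s.
rewrite mem_filter mem_permutations hsort hsu /=.
have [h|] := boolP (perm_eq s u); last by rewrite andbF.
by rewrite (hP _ _ h) hPu (hB _ _ h) hu.
Qed.

(** Carrying [hP] as an argument lets the closure instance below be inferred from the predicate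
    itself. *)
Definition subspace_pred n (P : fn n -> Prop) (hP : subspace P) : {pred fn n} :=
  fun f => `[<P f>].

Lemma subspace_pred_closed n (P : fn n -> Prop) (hP : subspace P) :
  zmod_closed (subspace_pred hP).
Proof.
split=> [|f g]; first by apply/asboolP; exact: subspace0.
move=> /asboolP hf /asboolP hg; apply/asboolP; apply: subspaceD => //.
exact: subspaceN.
Qed.

HB.instance Definition _ n (P : fn n -> Prop) (hP : subspace P) :=
  GRing.isZmodClosed.Build (fn n) (subspace_pred hP) (subspace_pred_closed hP).

(** Only the additive structure is kept: the coefficients met in straightening are integers. *)
Lemma subspace_quotient n (P : fn n -> Prop) : subspace P ->
  exists (V : zmodType) (pi : {additive fn n -> V}), forall f, pi f = 0 <-> P f.
Proof.
move=> hP; pose Q : zmodType := Quotient.quot (subspace_pred hP).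
exists Q, (\pi_Q)%qT => f.
have -> : (\pi_Q f)%qT = 0 <-> (f == 0 %[mod Quotient.quot (subspace_pred hP)])%qT.
  by rewrite raddf0; split=> /eqP.
rewrite -Quotient.idealrBE subr0.
by split=> [/asboolP|h]; last exact/asboolP.
Qed.

(** * The relations curly-R *)

Definition monoword n (b : posroot n) (s : seq int) : word n := [seq (m, b) | m <- s].

Section Monoword.
Variables (n : nat) (b : posroot n).
Implicit Types (s : seq int) (a : word n).

Lemma fst_monoword s : map fst (monoword b s) = s.
Proof. by rewrite -map_comp map_id. Qed.

Lemma monoword_inj : injective (monoword b).
Proof. exact: can_inj fst_monoword. Qed.

Lemma monoword_fst a : all (fun x => x.2 == b) a -> a = monoword b (map fst a).
Proof. by elim: a => [|[m c] a IH] //= /andP[/eqP -> /IH {1}->]. Qed.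

Lemma deg_monoword s : deg (monoword b s) = \sum_(x <- s) x.
Proof. by rewrite /deg big_map. Qed.

Lemma all_monoword s : all (fun x => x.2 == b) (monoword b s).
Proof. by rewrite all_map; apply/allP => x _ /=; rewrite eqxx. Qed.

Lemma zip_nseq s : zip s (nseq (size s) b) = monoword b s.
Proof. by elim: s => [|x s IH] //=; rewrite IH. Qed.
End Monoword.

(* The coefficient of curly-R at [monoword (sroot i) s], once the length and the
   sum of [s] are right. *)
Definition Rcoef (s : seq int) : nat :=
  (all (fun x => x <= -1 :> int)%R s +
   if sorted <=%R s && (0 <= last 0 s)%R then mcoef s else 0)%N.

Section Rcal.
Variables (n k : nat) (i : 'I_n).

Lemma Rm1_monoword t s : s \in box k.+1 t%:Z (-1) -> Rm1 k i t (monoword (sroot i) s) = 1.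
Proof.
rewrite mem_box => /and3P[/eqP hs /eqP ht ha].
have {}ha : all (fun x : letter n => (x.2 == sroot i) && (x.1 <= -1)) (monoword (sroot i) s).
  by rewrite all_map; apply: sub_all ha => x /= ->; rewrite eqxx.
by rewrite /Rm1 size_map hs eqxx ha -/(deg _) deg_monoword ht eqxx.
Qed.

Lemma Rm1_neq0 t a : Rm1 k i t a != 0 ->
  exists2 s, s \in box k.+1 t%:Z (-1) & a = monoword (sroot i) s.
Proof.
rewrite /Rm1; case: andP => [[/andP[/eqP hs ha] /eqP ht] _|_]; last by rewrite eqxx.
have ha2 : all (fun x => x.2 == sroot i) a by apply: sub_all ha => x /andP[].
exists (map fst a); last exact: monoword_fst.
rewrite mem_box size_map hs eqxx big_map ht eqxx /= all_map.
by apply: sub_all ha => x /andP[].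
Qed.

Lemma Rm1E t :
  Rm1 k i t = \sum_(s <- box k.+1 t%:Z (-1)) Xw (monoword (sroot i) s).
Proof.
rewrite -(big_map (monoword (sroot i)) predT (@Xw n)).
set L := map _ _; have uL : uniq L by rewrite map_inj_uniq ?box_uniq //; exact: monoword_inj.
transitivity (\sum_(a <- L) Rm1 k i t a *: Xw a).
  rewrite sum_Xw //; apply/funext => a; case: ifPn => // ha.
  apply/eqP; apply: contraNT ha => /Rm1_neq0[s hs ->].
  exact: map_f.
by rewrite !big_map; apply: eq_big_seq => s hs; rewrite Rm1_monoword // scale1r.
Qed.

Lemma Rcal_monoword t s : sumset k.+1 t%:Z s ->
  Rcal k i t (monoword (sroot i) s) = (Rcoef s)%:R.
Proof.
move=> [hs ht]; rewrite /Rcal /Rcoef natrD; congr (_ + _); last first.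
  rewrite size_map hs eqxx all_monoword fst_monoword -/(deg _) deg_monoword ht eqxx /=.
  by case: ifP.
rewrite /Rm1 size_map hs eqxx -/(deg _) deg_monoword ht eqxx andbT /= all_map.
by rewrite (@eq_all _ _ (fun x : int => x <= -1)) // => x /=; rewrite eqxx.
Qed.

Lemma Rcal_neq0 t a : Rcal k i t a != 0 ->
  exists2 s, sumset k.+1 t%:Z s & a = monoword (sroot i) s.
Proof.
rewrite /Rcal; have [->|/Rm1_neq0[s hs ->] _] := eqVneq (Rm1 k i t a) 0; last first.
  by exists s => //; move: hs; rewrite mem_box => /and3P[/eqP ? /eqP ? _].
rewrite add0r; case: ifP => [/and5P[/eqP hs ha _ /eqP ht _] _|_]; last by rewrite eqxx.
exists (map fst a); last exact: monoword_fst.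
by split; rewrite ?size_map ?big_map.
Qed.

Lemma le_last_sorted (s : seq int) N :
  sorted <=%R s -> s != [::] -> last 0 s <= N -> all (fun x => x <= N) s.
Proof.
case/lastP: s => [|s x] // hs _; rewrite last_rcons => hx; apply/allP => y.
rewrite mem_rcons inE => /orP[/eqP -> //|hy]; apply: le_trans hx.
move: hs; rewrite -cats1 (sorted_pairwise le_trans) pairwise_cat /=.
by case/and3P => /allrelP h _ _; apply: h => //; rewrite inE.
Qed.

(** Since [N >= -1], an entry above [N] excludes the all-negative part; the coefficient then comes
    from the sorted part, where the last entry is the largest. *)
Lemma Rcoef_large s N : s != [::] -> -1 <= N ->
  Rcoef s != 0%N -> ~~ all (fun x => x <= N) s -> N < last 0 s.
Proof.
move=> hs hN hc hn; rewrite ltNge; apply/negP => hl.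
move: hc; rewrite /Rcoef (_ : all _ s = false); last first.
  by apply: contraNF hn => /sub_all; apply => x; lia.
case: ifP => // /andP[hsort _] _; case/negP: hn.
exact: le_last_sorted.
Qed.

(** Outside a finite box the support of curly-R consists of words whose last letter has large index.
    This gives both its membership in F and the vanishing of its tail before a fixed word. *)
Lemma Rcal_large t a N : -1 <= N -> Rcal k i t a != 0 ->
  a \notin map (monoword (sroot i)) (box k.+1 t%:Z N) ->
  exists b x, a = rcons b x /\ N < x.1.
Proof.
move=> hN ha hn; have [s hs Ea] := Rcal_neq0 ha; subst a.
have s0 : s != [::] by case: hs => + _; case: (s).
have hc : Rcoef s != 0%N.
  by apply: contraNneq ha => hc; rewrite Rcal_monoword // hc.
have {}hn : ~~ all (fun x => x <= N) s.
  apply: contra hn => hn; apply: map_f; rewrite mem_box hn andbT.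
  by case: hs => -> ->; rewrite !eqxx.
have := Rcoef_large s0 hN hc hn; case/lastP: (s) s0 => // s' x _.
by rewrite last_rcons /monoword map_rcons => hx; exists (monoword (sroot i) s'), (x, sroot i).
Qed.

Lemma inF_Rcal t : inF (Rcal k i t).
Proof.
move=> j; pose N := Num.max j (-1).
exists (map (monoword (sroot i)) (box k.+1 t%:Z N)) => a ha h0.
apply/negPn/negP => hn.
have [|b [x [Ea hx]]] := @Rcal_large t a N _ h0 hn; first by rewrite /N; lia.
move: ha; rewrite Ea -cats1 => /word_le_cat[_ /(_ 0%N isT)].
by rewrite /= big_seq1; move: hx; rewrite /N; lia.
Qed.

(** Against a symmetric [F], curly-R acts as the sum of all sequences with coefficient 1:
    all-negative ones already have it, and each remaining sorted one represents its [mcoef]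
    rearrangements. This identifies curly-R with a mode of a product of commuting fields. *)
Lemma sum_Rcoef (V : zmodType) (t N : int) (F : seq int -> V) : -1 <= N ->
  (forall s u, perm_eq s u -> F s = F u) ->
  \sum_(s <- box k.+1 t N) F s *+ Rcoef s = \sum_(s <- box k.+1 t N) F s.
Proof.
move=> hN hF.
have hB s u : perm_eq s u -> (s \in box k.+1 t N) = (u \in box k.+1 t N).
  by move=> h; rewrite !mem_box (perm_size h) (perm_all _ h) (perm_big _ h).
pose P (s : seq int) := ~~ all (fun x => x <= -1) s.
have hP s u : perm_eq s u -> P s = P u by move=> /perm_all h; rewrite /P h.
rewrite [RHS](bigID P) /= addrC (sum_sorted (box_uniq _ _ _) hB hP hF).
rewrite [X in _ = X + _]big_mkcond [X in _ = _ + X]big_mkcond -big_split.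
apply: eq_big_seq => s.
rewrite mem_box => /and3P[/eqP hs _ _] /=; rewrite /Rcoef mulrnDr; congr (_ + _).
  by rewrite /P negbK; case: ifP.
case hsort: (sorted <=%R s) => /=; last by rewrite andbF.
(* For a sorted nonempty sequence, some entry is nonnegative exactly when the last one is. *)
rewrite andbT (_ : P s = (0 <= last 0 s)); first by case: ifP.
have s0 : s != [::] by case: (s) hs.
rewrite leNgt /P; congr negb; apply/allP/idP => [h|h x hx]; last first.
  have /allP -> // : all (fun x => x <= -1) s.
  by apply: le_last_sorted => //; lia.
have : last 0 s <= -1 by apply: h; case: (s) s0 => // x s' _; exact: (mem_last x s').
by lia.
Qed.

End Rcal.

(** * The comparison *)

Lemma mulF_sandwichB n (f g A B C : fn n) :
  mulF (mulF f (addF (addF A (scaleF (-1) B)) (scaleF (-1) C))) g =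
  mulF (mulF f A) g - mulF (mulF f B) g - mulF (mulF f C) g.
Proof.
rewrite !addFE !scaleFE !mulFDr !mulFDl !mulFZr !mulFZl.
by rewrite !scaleN1r.
Qed.

Lemma Itil_word n (p q : word n) m l a b :
  Itil (Xw (p ++ [:: (m, a), (l, b) & q]) - Xw (p ++ [:: (l, b), (m, a) & q]) -
    (if rootsum a b is Some g then Xw (p ++ (m + l, g) :: q) *~ csign a b else 0)).
Proof.
have mulXw3 x : mulF (mulF (Xw p) (Xw x)) (Xw q) = Xw (p ++ x ++ q).
  by rewrite [mulF (Xw p) _]mulXw mulXw catA.
have hC : mulF (mulF (Xw p) (if rootsum a b is Some c
      then scaleF (Cst a b) (Xl c (m + l)) else @zeroF n)) (Xw q) =
    (if rootsum a b is Some g then Xw (p ++ (m + l, g) :: q) *~ csign a b else 0).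
  case E: rootsum => [g|]; last by rewrite mulF0 mul0F.
  rewrite scaleFE mulFZr mulFZl mulXw3 /= /csign.
  move: E; rewrite /rootsum /Cst; case: eqP => [_ _|_]; first by rewrite scale1r.
  by case: eqP => [_ _|//]; rewrite scaleN1r mulrN1z.
rewrite -(mulXw3 [:: (m, a); (l, b)]) -(mulXw3 [:: (l, b); (m, a)]) -hC -mulF_sandwichB.
by apply: ideal2_gen; [exact: inF_Xw | exists a, b, m, l | exact: inF_Xw].
Qed.

Section Main.
Variables (n k : nat).

Let T := plusS (plusS (lidealT (@IkL0gens n k)) (@Nplus n)) (@Itil n).

Let hL : subspace (lidealT (@IkL0gens n k)) := lidealT_subspace _.
Let hN : subspace (@Nplus n) := @Nplus_subspace n.
Let hI : subspace (@Itil n) := ideal2_subspace _.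
Let hLN : subspace (plusS (lidealT (@IkL0gens n k)) (@Nplus n)) := plusS_subspace hL hN.
Let hT : subspace T := plusS_subspace hLN hI.

Let Nplus_T f : Nplus f -> T f.
Proof. by move=> hf; apply: plusSl => //; exact: plusSr. Qed.

(** Straightening is applied in the quotient by [Nplus] and [Itil] to [k + 1] copies of the simple
    root, with [W] the image of the left ideal. *)
Lemma Rcal_words (i : 'I_n) t (p a : word n) :
  T (mulF (mulF (Xw p) (Rcal k i t)) (Xw a)).
Proof.
have hK : subspace (plusS (@Nplus n) (@Itil n)) := plusS_subspace hN hI.
have [V [pi hpi]] := subspace_quotient hK.
pose w (b : word n) := pi (Xw b).
have pi_Nplus f : Nplus f -> pi f = 0 by move=> hf; apply/hpi/plusSl.
have w_Mplus b : Mplus b -> w b = 0 by move=> hb; exact/pi_Nplus/Nplus_Xw.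
have w_comm b c m l x y :
    w (b ++ [:: (m, x), (l, y) & c]) = w (b ++ [:: (l, y), (m, x) & c]) +
    (if rootsum x y is Some g then w (b ++ (m + l, g) :: c) *~ csign x y else 0).
  have /(plusSr hN)/hpi := Itil_word b c m l x y.
  rewrite !raddfB /= -/(w _) => /eqP; rewrite subr_eq0 subr_eq addrC => /eqP ->.
  by case: rootsum => [g|]; rewrite ?raddf0 // raddfMz.
pose al := sroot i; pose G := nseq k.+1 al.
have hG : all (through i) G by rewrite all_nseq /through /rlo /rhi /= !leqnn ?orbT.
have zipG s : size s = k.+1 -> zip s G = monoword al s.
  by move=> hs; rewrite /G -hs zip_nseq.
have mode_monoword N t' p' a' : 0 <= N + 1 + deg a' -> mode w t' p' G a' =
    \sum_(s <- box k.+1 t' N) w (p' ++ monoword al s ++ a').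
  move=> hNa; rewrite (mode_box w_comm w_Mplus t' p' hG hNa) size_nseq.
  apply: eq_big_seq => s; rewrite mem_box => /and3P[/eqP hs _ _].
  by rewrite zipG.
pose W v := exists2 f, lidealT (@IkL0gens n k) f & v = pi f.
have W_vacuum t' p' : W (mode w t' p' G [::]).
  rewrite (@mode_monoword (-1)) /deg ?big_nil //.
  (* The index [t'] is an arbitrary integer, as brackets shift it. If [t' < k + 1] the box is empty,
     because [k + 1] indices at most -1 sum to at most [- (k + 1)]; otherwise the box sum is a left
     multiple of a generator. *)
  have [ht|ht] := lerP k.+1%:Z t'; last first.
    exists 0; first exact: subspace0.
    rewrite raddf0 big_seq big1 // => s; rewrite mem_box => /and3P[/eqP hs /eqP hsum ha].
    by have := sum_le_bound ha; rewrite hs hsum; lia.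
  have [t0 Et] : exists t0 : nat, t' = t0%:Z by exists `|t'|%N; lia.
  subst t'; exists (mulF (Xw p') (Rm1 k i t0)).
    apply: lidealT_gen; first exact: finsupp_Xw.
    by left; exists i, t0.
  rewrite Rm1E mulF_sumr raddf_sum; apply: eq_bigr => s _.
  by rewrite cats0 mulXw.
have W_add x y : W x -> W y -> W (x + y).
  by move=> [f hf ->] [g hg ->]; exists (f + g); rewrite ?raddfD //; exact: subspaceD.
have W_opp x : W x -> W (- x).
  by move=> [f hf ->]; exists (- f); rewrite ?raddfN //; exact: subspaceN.
have modes1 t' p' a' : modes w t' p' [:: (1, G)] a' = mode w t' p' G a'.
  by rewrite /modes big_seq1 mulr1z.
have [|t' p'|f hf Ef] := @modes_mem _ _ _ w_comm w_Mplus i W W_add W_opp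
    [:: (1, G)] a _ _ t%:Z p.
- by apply/andP; split; first exact: hG.
- by rewrite modes1.
suff Epi : pi (mulF (mulF (Xw p) (Rcal k i t)) (Xw a)) = pi f.
  have /hpi/plusSE[g1 [g2 [h1 h2 h]]] :
      pi (mulF (mulF (Xw p) (Rcal k i t)) (Xw a) - f) = 0.
    by rewrite raddfB Epi subrr.
  apply/plusSE; exists (f + g1), g2; split => //; last by rewrite -addrA -h addrC subrK.
  by apply/plusSE; exists f, g1.
rewrite -Ef modes1; pose N : int := `|deg a|.
rewrite (@mode_monoword N); last by rewrite /N; lia.
have hN1 : -1 <= N by rewrite /N; lia.
(* Letters with the same simple root commute under [w], so the summand is symmetric and the
   coefficients 1 of the mode may be traded for those of curly-R. *)
rewrite -(@sum_Rcoef k V t%:Z N (fun s => w (p ++ monoword al s ++ a)) hN1); last first.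
  move=> s u hsu; apply: (w_perm w_comm (i := i)); last exact: perm_map.
  by rewrite all_map; apply/allP => x _ /=; rewrite /through /rlo /rhi /= leqnn.
pose L := map (monoword al) (box k.+1 t%:Z N).
have uL : uniq L by rewrite map_inj_uniq ?box_uniq //; exact: monoword_inj.
have [R' [ER inFR' ER']] := inF_split uL (@inF_Rcal n k i t).
have R'_neq0 b : R' b != 0 -> b \notin L /\ Rcal k i t b != 0.
  by rewrite ER'; case: ifP => //; rewrite eqxx.
(* Each word of the tail [R'] ends in a letter of index above [|deg a|]; followed by [a] it gives a
   suffix of positive degree, so the tail dies in the quotient. *)
rewrite ER mulFDr mulFDl raddfD [X in _ + X]pi_Nplus ?addr0; last first.
  rewrite mulFA; apply: Nplus_mull; first exact: inF_Xw.
  apply: NplusP => [|b]; first exact: inF_mul (inF_Xw a).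
  move=> /mulF_neq0[c [c' [-> /R'_neq0[hc0 hc1] /Xw_neq0 ->]]].
  have [d [x [-> hx]]] := Rcal_large hN1 hc1 hc0.
  rewrite cat_rcons; apply: Mplus_suffix => //.
  by rewrite /deg big_cons -/(deg a); move: hx; rewrite /N; lia.
rewrite mulF_sumr mulF_suml raddf_sum big_map; apply: eq_big_seq => s.
rewrite mem_box => /and3P[/eqP hs /eqP ht _].
by rewrite Rcal_monoword // mulFZr mulFZl !mulXw -catA scaler_nat raddfMn.
Qed.

(** Both outer factors are cut down to finite combinations of words, the right one first because the
    cutoff for [f] depends on the word [a] taken from [h]. *)
Lemma Rcal_mem (i : 'I_n) t (f h : fn n) : inF f -> inF h ->
  T (mulF (mulF f (Rcal k i t)) h).
Proof.
move=> hf hh; have hR := @inF_Rcal n k i t.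
have [L [h' [-> hh' h0]]] := inF_decomp (-1) hh.
rewrite mulFDr mulF_sumr; apply: (subspaceD hT); last first.
  apply/Nplus_T/Nplus_mull; first exact: inF_mul.
  by split=> // a /word_le_Mplus; exact: h0.
apply: (subspace_sum hT) => a; rewrite mulFZr; apply: (subspaceZ hT).
(* Words of curly-R have degree [- t]. A prefix beyond this cutoff has a suffix of degree at least
   [t - deg a], which makes the total degree from there on nonnegative. *)
have [L' [f' [-> hf' f0]]] := inF_decomp (t%:Z - deg a - 1) hf.
rewrite !mulFDl; apply: (subspaceD hT).
  rewrite !mulF_suml; apply: (subspace_sum hT) => p.
  by rewrite !mulFZl; apply: (subspaceZ hT); exact: Rcal_words.
apply: Nplus_T; apply: NplusP => [|b].
  by do 2?[apply: inF_mul => //]; exact: inF_Xw.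
rewrite mulFA => /mulF_neq0[p [c [-> hp]]].
move=> /mulF_neq0[c' [a' [-> /Rcal_neq0[s [_ hs] ->] /Xw_neq0 ->]]].
have /not_word_le[p1 [p2 [-> hp2 hd]]] : ~ word_le (t%:Z - deg a - 1) p.
  by move=> /f0 fp0; move: hp; rewrite fp0 eqxx.
rewrite -catA; apply: Mplus_suffix; first by case: (p2) hp2.
by rewrite !deg_cat deg_monoword hs; lia.
Qed.

Lemma Jid_mem f : @Jid n k f -> T f.
Proof.
apply: ideal2_sub => // g _ h hg [i [t [_ ->]]] hh; exact: Rcal_mem.
Qed.

(** The difference is supported on words whose last letter has nonnegative index. *)
Lemma Rm1_sub_Rcal (i : 'I_n) t : Nplus (Rm1 k i t - Rcal k i t).
Proof.
have hR := @inF_Rcal n k i t.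
apply: NplusP => [|a].
  apply: inFD; last by rewrite -scaleN1r; exact: inFZ.
  rewrite Rm1E; apply: finsupp_inF; exists (map (monoword (sroot i)) (box k.+1 t%:Z (-1))).
  by move=> a; rewrite -Rm1E => /Rm1_neq0[s hs ->]; exact: map_f.
rewrite -[(_ - _) a]/(Rm1 k i t a - Rcal k i t a) /Rcal opprD addNKr oppr_eq0.
case: ifP => [/and5P[hs _ _ _ hl] _|_]; last by rewrite eqxx.
case/lastP: a hs hl => // c x _; rewrite map_rcons last_rcons -cats1 => hx.
by apply: Mplus_suffix => //; rewrite /deg big_seq1.
Qed.

(** The easy inclusion, valid already in F: modulo [Nplus] the generators [Rm1] become curly-R, and
    the letters of nonnegative index vanish. *)
Lemma lidealT_mem f : lidealT (@IkL0gens n k) f ->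
  plusS (@Jid n k) (@Nplus n) f.
Proof.
have hJ : subspace (@Jid n k) := ideal2_subspace _.
apply: lidealT_sub; first exact: plusS_subspace.
move=> t g ht [[i [s [hs ->]]]|[b [m [hm ->]]]].
  apply/plusSE; exists (mulF t (Rcal k i s)), (mulF t (Rm1 k i s - Rcal k i s)).
  split; last by rewrite -mulFDr addrC subrK.
    rewrite -[mulF _ _]mulF1; apply: ideal2_gen; [exact: finsupp_inF | by exists i, s|].
    exact: inF_Xw.
  by apply: Nplus_mull; [exact: finsupp_inF | exact: Rm1_sub_Rcal].
apply: plusSr => //; apply: Nplus_mull; first exact: finsupp_inF.
apply: Nplus_Xw; apply: (@Mplus_suffix n [::]) => //.
by rewrite /deg big_seq1.
Qed.

End Main.

Theorem theorem4p4 (n k : nat) (hn : (2 <= n)%N) (hk : (1 <= k)%N) :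
  eq_mod_Itil (plusS (lidealT (@IkL0gens n k)) (@Nplus n))
              (plusS (@Jid n k) (@Nplus n))
  /\
  (forall kk : 'I_n.+1 -> nat, (\sum_(s < n.+1) kk s)%N = k ->
     eq_mod_Itil
       (plusS (lidealT (unionS (@IkL0gens n k) (Lamgens k kk))) (@Nplus n))
       (plusS (plusS (@Jid n k) (lidealT (Lamgens k kk))) (@Nplus n))).
Proof.
have hL S : subspace (@lidealT n S) := lidealT_subspace S.
have hN : subspace (@Nplus n) := @Nplus_subspace n.
have hI : subspace (@Itil n) := ideal2_subspace _.
have hJ : subspace (@Jid n k) := ideal2_subspace _.
have sub := plusS_subspace.
split=> [|kk _] mu; split.
- apply: plusS_sub; first by auto.
    apply: plusS_sub; first by auto.
      by move=> f /lidealT_mem; apply: plusSl.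
    by move=> f hf; apply: plusSl => //; apply: plusSr.
  by move=> f; apply: plusSr; auto.
- apply: plusS_sub; first by auto.
    apply: plusS_sub; first by auto.
      exact: Jid_mem.
    by move=> f hf; apply: plusSl => //; apply: plusSr.
  by move=> f; apply: plusSr; auto.
- apply: plusS_sub; first by auto.
    apply: plusS_sub; first by auto.
      apply: lidealT_sub; first by auto.
      (* The generators attached to the weight occur on both sides, so only those of the vacuum case
         need the comparison. *)
      move=> t g ht [hg|hg].
        have /lidealT_mem/plusSE[f1 [f2 [h1 h2 ->]]] := lidealT_gen ht hg.
        apply: plusSl => //; apply/plusSE; exists f1, f2; split => //.
        exact: plusSl.
      by apply: plusSl => //; apply: plusSl => //; apply: plusSr => //; exact: lidealT_gen.
    by move=> f hf; apply: plusSl => //; apply: plusSr => //; auto.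
  by move=> f; apply: plusSr; auto.
have mono (A B : fn n -> Prop) : (forall g, A g -> B g) ->
    forall f, lidealT A f -> lidealT B f.
  by move=> hAB; apply: lidealT_sub => // t g ht /hAB; exact: lidealT_gen.
apply: plusS_sub; first by auto.
  apply: plusS_sub; first by auto.
    apply: plusS_sub; first by auto.
      move=> f /Jid_mem/plusSE[f1 [f2 [/plusSE[g1 [g2 [h1 h2 ->]]] h3 ->]]].
      apply/plusSE; exists (g1 + g2), f2; split => //; apply/plusSE; exists g1, g2.
      by split => //; apply: mono h1 => g hg; left.
    move=> f hf; apply: plusSl => //; apply: plusSl => //.
    by apply: mono hf => g hg; right.
  by move=> f hf; apply: plusSl => //; apply: plusSr.
by move=> f; apply: plusSr; auto.
Qed.
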